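(* Let $G$ be a finite group, let $N$ be a normal subgroup of $G$, and let $\theta$ be a self-dual irreducible $2$-Brauer character of $G$ of non-quadratic type which does not lie over the trivial character of $N$ (i.e. the trivial Brauer character of $N$ is not a constituent of $\theta{\downarrow_N}$). Then $\theta{\downarrow_N}$ is a sum of self-dual irreducible $2$-Brauer characters of $N$ of non-quadratic type, each occurring with multiplicity $1$.
   Context: Fix a $2$-modular system $(K,R,F)$: $R$ is a complete discrete valuation ring with field of fractions $K$ of characteristic $0$ and residue field $F=R/J(R)$ of characteristic $2$; $K$ and $F$ are assumed to be splitting fields for all subgroups of $G$. The irreducible $2$-Brauer characters of $G$ are the Brauer characters of the irreducible $FG$-modules; they are $R$-valued class functions on the odd order elements of $G$. The dual of $\theta$ is $\overline{\theta}(g)=\theta(g^{-1})$, and $\theta$ is self-dual if $\theta=\overline{\theta}$. $\theta{\downarrow_N}$ denotes restriction to $N$. A non-trivial irreducible $2$-Brauer character of a group is of quadratic type if the corresponding irreducible module over $F$ affords a non-zero group-invariant quadratic form with values in $F$; a non-trivial self-dual irreducible $2$-Brauer character is of non-quadratic type if it is not of quadratic type. (For an irreducible Brauer character $\theta$ of $G$ and an irreducible Brauer character $\varphi$ of the normal subgroup $N$, $\theta$ is a constituent of $\varphi{\uparrow^G}$ if and only if $\varphi$ is a constituent of $\theta{\downarrow_N}$; in this case $\theta$ lies over $\varphi$.) *)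

(* Defs.v *)
From HB Require Import structures.
From mathcomp Require Import all_boot all_order all_algebra.
From mathcomp Require Import all_fingroup all_solvable all_field all_character.

Set Implicit Arguments.
Unset Strict Implicit.
Unset Printing Implicit Defensive.

Import GRing.Theory.
Local Open Scope ring_scope.

(* idealr_closed includes properness, so the whole ring is not an instance;   *)
(* this loses nothing below (the unit ideal is always principal).             *)
Definition maximal_ideal (R : comNzRingType) (M : {pred R}) : Prop :=
  idealr_closed M /\
  forall I : {pred R}, idealr_closed I -> {subset M <= I} -> I =i M.

Definition jacobson (R : comNzRingType) (x : R) : Prop :=
  forall M : {pred R}, maximal_ideal M -> x \in M.

Definition generates (R : comNzRingType) (a : R) (I : R -> Prop) : Prop :=
  forall x, I x <-> exists c, x = c * a.

(* A local principal ideal domain which is not a field.                       *)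
Definition discrete_valuation_ring (R : idomainType) : Prop :=
  (forall I : {pred R}, idealr_closed I ->
     exists a, generates a (fun x => x \in I)) /\
  exists M : {pred R},
    [/\ maximal_ideal M,
        forall M' : {pred R}, maximal_ideal M' -> M' =i M
      & exists2 x, x \in M & x != 0].

(* Convergence of Cauchy sequences in the J(R)-adic topology, where J(R) is   *)
(* principal with generator pi, so that J(R)^n is generated by pi ^+ n.       *)
Definition complete_dvr (R : idomainType) : Prop :=
  discrete_valuation_ring R /\
  forall pi : R, generates pi (@jacobson R) ->
  forall u : nat -> R,
    (forall n, exists m, forall i j, (m <= i)%N -> (m <= j)%N ->
       exists c, u i - u j = c * pi ^+ n) ->
    exists l, forall n, exists m, forall i, (m <= i)%N ->
       exists c, u i - l = c * pi ^+ n.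

(* The identifications K = Frac(R) and F = R / J(R) are given by the ring     *)
(* morphisms iota and rho.                                                    *)
Record modular_system (p : nat) (K : fieldType) (R : idomainType)
    (F : fieldType) (iota : {rmorphism R -> K}) (rho : {rmorphism R -> F}) :
    Prop := ModularSystem {
  ms_complete : complete_dvr R;
  ms_frac_inj : injective iota;
  ms_frac : forall z : K, exists a b : R, b != 0 /\ z = iota a / iota b;
  ms_pchar_frac : [pchar K] =i pred0;
  ms_res_surj : forall y : F, exists x : R, rho x = y;
  ms_res_ker : forall x : R, rho x = 0 <-> jacobson x;
  ms_pchar_res : p \in [pchar F]
}.

(* 2-Brauer characters of H <= gT are functions on gT that vanish outside the *)
(* odd order elements of H, so that equality of finfuns is equality of class  *)
(* functions on the odd order elements of H.                                  *)
Definition odd_elt (gT : finGroupType) (H : {set gT}) (g : gT) : bool :=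
  (g \in H) && odd #[g]%g.

(* On odd order elements of H, chi g is the sum of the lifts to roots of      *)
(* unity of R of the eigenvalues (with multiplicity) of the action of g. For  *)
(* odd m, rho is injective on the m-th roots of unity when char F = 2, so chi *)
(* is determined by rH.                                                       *)
Definition affords_brauer (R : idomainType) (F : fieldType)
    (rho : {rmorphism R -> F}) (gT : finGroupType) (H : {group gT}) (n : nat)
    (rH : mx_representation F H n) (chi : {ffun gT -> R}) : Prop :=
  forall g : gT,
    if odd_elt H g then
      exists s : seq R,
        [/\ forall x, x \in s -> x ^+ #[g]%g = 1,
            char_poly (rH g) = \prod_(x <- s) ('X - (rho x)%:P)
          & chi g = \sum_(x <- s) x]
    else chi g = 0.

Definition irr_brauer (R : idomainType) (F : fieldType)
    (rho : {rmorphism R -> F}) (gT : finGroupType) (H : {group gT})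
    (phi : {ffun gT -> R}) : Prop :=
  exists n (rH : mx_representation F H n),
    mx_irreducible rH /\ affords_brauer rho rH phi.

Definition brauer1 (R : idomainType) (gT : finGroupType) (H : {group gT}) :
    {ffun gT -> R} :=
  [ffun g => if odd_elt H g then 1 else 0].

Definition brauer_dual (R : idomainType) (gT : finGroupType)
    (phi : {ffun gT -> R}) : {ffun gT -> R} :=
  [ffun g => phi g^-1%g].

Definition brauer_res (R : idomainType) (gT : finGroupType) (N : {group gT})
    (phi : {ffun gT -> R}) : {ffun gT -> R} :=
  [ffun g => if g \in N then phi g else 0].

(* By linear independence of the irreducible Brauer characters, s is unique   *)
(* up to permutation.                                                         *)
Definition brauer_constituent (R : idomainType) (F : fieldType)
    (rho : {rmorphism R -> F}) (gT : finGroupType) (H : {group gT})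
    (phi chi : {ffun gT -> R}) : Prop :=
  exists s : seq {ffun gT -> R},
    [/\ forall psi, psi \in s -> irr_brauer rho H psi,
        chi = \sum_(psi <- s) psi
      & phi \in s].

(* The polar form is symmetric, so linearity in one argument is bilinearity.  *)
Definition quadratic_form (F : fieldType) (n : nat) (Q : 'rV[F]_n -> F) :
    Prop :=
  (forall (a : F) (v : 'rV[F]_n), Q (a *: v) = a ^+ 2 * Q v) /\
  (forall u : 'rV[F]_n, scalar (fun v => Q (u + v) - Q u - Q v)).

Definition has_invariant_quadratic_form (F : fieldType) (gT : finGroupType)
    (H : {group gT}) (n : nat) (rH : mx_representation F H n) : Prop :=
  exists Q : 'rV[F]_n -> F,
    [/\ quadratic_form Q,
        exists v, Q v != 0
      & forall g v, g \in H -> Q (v *m rH g) = Q v].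

(* An irreducible module is determined up to isomorphism by its Brauer        *)
(* character.                                                                 *)
Definition quadratic_type (R : idomainType) (F : fieldType)
    (rho : {rmorphism R -> F}) (gT : finGroupType) (H : {group gT})
    (phi : {ffun gT -> R}) : Prop :=
  phi <> brauer1 R H /\
  exists n (rH : mx_representation F H n),
    [/\ mx_irreducible rH, affords_brauer rho rH phi
      & has_invariant_quadratic_form rH].

Definition non_quadratic_type (R : idomainType) (F : fieldType)
    (rho : {rmorphism R -> F}) (gT : finGroupType) (H : {group gT})
    (phi : {ffun gT -> R}) : Prop :=
  [/\ irr_brauer rho H phi, phi <> brauer1 R H, brauer_dual phi = phi
    & ~ quadratic_type rho H phi].

(* Main.v *)
Require Import Defs.
From HB Require Import structures.
From mathcomp Require Import all_boot all_order all_algebra.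
From mathcomp Require Import all_fingroup all_solvable all_field all_character.
From mathcomp Require Import ring.
From Stdlib Require Import Classical_Prop.

Set Implicit Arguments.
Unset Strict Implicit.
Unset Printing Implicit Defensive.

Import GRing.Theory.
Local Open Scope ring_scope.

(* Let V afford theta.  Self-duality gives a nondegenerate G-invariant form B
   on V; since V has no nonzero N-fixed vectors and the diagonal of B is a
   fixed vector of the dual of the Frobenius twist V', B is alternating.
   Choose any quadratic form Q0 with polar form B.  The maps Q0(v g) - Q0(v)
   are linear on V', hence define an extension of V' by the trivial module,
   which splits over a subgroup exactly when B is the polar form of a
   quadratic form invariant under that subgroup.  Invariant forms for N are
   unique because V' has no trivial N-quotient, so non-splitting over G forces
   non-splitting over N; as V' is irreducible, Clifford's theorem then shows
   that no nonzero N-submodule of V' lifts to the extension.  An N-submodule W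
   of V which is isotropic, or carries an invariant quadratic form, would lift,
   and so would a combination of two isomorphic submodules W1 and W2, because
   the restrictions of B to W1 and W2 are proportional. *)

(** * Representations and traces *)

(** The kernel of [B] is a submodule of [r1]. As [g] is a mere function, the lemma also applies to
    [x -> (rH x^-1)^T], where [B] is a bilinear form. *)
Lemma irr_hom_free (F : fieldType) (gT : finGroupType) (H : {group gT})
    n1 n2 (r1 : mx_representation F H n1) (g : gT -> 'M_n2) (B : 'M_(n1, n2)) :
    mx_irreducible r1 -> B != 0 ->
    (forall x, x \in H -> r1 x *m B = B *m g x) ->
  row_free B.
Proof.
move=> /mx_irrP[_ irr1] nzB homB.
rewrite -kermx_eq0; apply: contraNT nzB => nzK.
have fullK: row_full (kermx B).
  apply: irr1 nzK; apply/mxmoduleP=> x Gx.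
  by apply/sub_kermxP; rewrite -mulmxA homB // mulmxA mulmx_ker mul0mx.
by rewrite -[B]mul1mx; apply/eqP/sub_kermxP; rewrite sub1mx.
Qed.

Lemma irr_hom_rsim (F : fieldType) (gT : finGroupType) (G : {group gT})
    n1 n2 (rG1 : mx_representation F G n1) (rG2 : mx_representation F G n2)
    (B : 'M_(n1, n2)) :
    mx_irreducible rG1 -> mx_irreducible rG2 -> B != 0 ->
    (forall x, x \in G -> rG1 x *m B = B *m rG2 x) ->
  mx_rsim rG1 rG2.
Proof.
move=> irr1 /mx_irrP[_ irr2] nzB homB.
have freeB := irr_hom_free irr1 nzB homB.
have fullB : row_full B.
  have: row_full <<B>>%MS.
    apply: irr2; last by rewrite (eqmx_eq0 (genmxE B)).
    by rewrite (eqmx_module _ (genmxE B)); apply/mxmoduleP=> x Gx;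
       rewrite -homB // submxMl.
  by rewrite /row_full genmxE.
by exists B => //; rewrite -(eqP freeB) (eqP fullB).
Qed.

(** By absolute irreducibility the group algebra acts on both modules as the full matrix algebra, so
    traces decide which of its elements act as zero; this works in every characteristic. *)
Lemma abs_irr_rsim_tr (F : fieldType) (gT : finGroupType) (G : {group gT})
    n1 n2 (rG1 : mx_representation F G n1) (rG2 : mx_representation F G n2) :
    mx_absolutely_irreducible rG1 -> mx_absolutely_irreducible rG2 ->
    {in G, forall x, \tr (rG1 x) = \tr (rG2 x)} ->
  mx_rsim rG1 rG2.
Proof.
move=> abs1 abs2 eq_tr; apply: mx_rsim_sym.
set aG := regular_repr F G; set R_G := group_ring F G.
have op_tr A: (A \in R_G)%MS -> \tr (gring_op rG1 A) = \tr (gring_op rG2 A).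
  case/envelop_mxP=> a ->; rewrite !linear_sum; apply: eq_bigr => x Gx /=.
  by rewrite !linearZ /= !gring_opG // eq_tr.
have op_onto n (rG : mx_representation F G n) :
    mx_absolutely_irreducible rG ->
  forall M, exists2 A, (A \in R_G)%MS & gring_op rG A = M.
  case/mx_abs_irrP=> _ [a aE] M; exists (\sum_(x in G) a x M *: aG x).
    by apply/envelop_mxP; exists (a ^~ M).
  rewrite linear_sum [RHS]aE; apply: eq_bigr => x Gx.
  by rewrite linearZ /= gring_opG.
(* The trace form is nondegenerate, so equality of traces forces the two
   representations of the group algebra to have the same kernel. *)
have op_ker A: (A \in R_G)%MS -> gring_op rG2 A = 0 -> gring_op rG1 A = 0.
  move=> R_A op2A; apply/matrixP=> i j; rewrite [RHS]mxE.
  have [C R_C defC] := op_onto _ _ abs1 (delta_mx j i).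
  have /eqP := op_tr (A *m C) (envelop_mxM R_A R_C).
  rewrite !gring_opM // defC op2A mul0mx mxtrace0 => /eqP <-.
  rewrite /mxtrace (bigD1 i) //= big1 ?addr0 => [|k /negPf neq_ki].
    rewrite [RHS]mxE (bigD1 j) //= [X in _ * X]mxE !eqxx mulr1.
    rewrite big1 ?addr0 // => l /negPf neq_lj.
    by rewrite [X in _ * X]mxE neq_lj mulr0.
  rewrite mxE big1 // => l _.
  by rewrite [X in _ * X]mxE neq_ki andbF mulr0.
have n2_gt0 : (0 < n2)%N by case/andP: abs2.
pose i0 := Ordinal n2_gt0.
have /fin_all_exists2[A R_A defA] (j : 'I_n2) :
  exists2 A, (A \in R_G)%MS & gring_op rG2 A = delta_mx i0 j by apply: op_onto.
have nz_op1 : gring_op rG1 (A i0) != 0.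
  apply/eqP=> /(congr1 mxtrace)/eqP; rewrite mxtrace0 op_tr // defA.
  rewrite /mxtrace (bigD1 i0) //= mxE !eqxx big1 ?addr0 ?oner_eq0 //.
  by move=> k /negPf neq_k; rewrite mxE neq_k.
have /rowV0Pn[v /submxP[u defv] nz_v] := nz_op1.
(* [A j] acts in [rG2] as the matrix unit taking basis vector [i0] to [j]. Sending [j] to [u] times
   the action of [A j] in [rG1] is equivariant because, by [op_ker], linear relations between
   actions in [rG2] persist in [rG1]. *)
apply: (@irr_hom_rsim _ _ _ _ _ _ _ (\matrix_j (u *m gring_op rG1 (A j)))).
- exact: mx_abs_irrW.
- exact: mx_abs_irrW.
- apply: contraNneq nz_v => B0; rewrite defv.
  by move/row_matrixP/(_ i0): B0; rewrite rowK row0 => ->.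
move=> x Gx; apply/row_matrixP=> j; rewrite !row_mul rowK mulmx_sum_row.
have R_x : (aG x \in R_G)%MS by apply: envelop_mx_id.
rewrite -mulmxA -[rG1 x]gring_opG // -gring_opM //; apply/eqP.
rewrite -subr_eq0; apply/eqP.
transitivity (u *m gring_op rG1 (\sum_k rG2 x j k *: A k - A j *m aG x)).
  rewrite linearB linear_sum mulmxBr mulmx_sumr; congr (_ - _).
  by apply: eq_bigr => k _; rewrite linearZ /= -scalemxAr rowK mxE.
rewrite op_ker ?mulmx0 //.
  rewrite linearB /= addmx_sub ?eqmx_opp ?envelop_mxM // linear_sum.
  apply: summx_sub => k _ /=; rewrite linearZ; apply: scalemx_sub; exact: R_A.
rewrite linearB linear_sum /= gring_opM // defA gring_opG //; apply/eqP.
rewrite subr_eq0; apply/eqP/matrixP=> a b; rewrite summxE mxE.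
under eq_bigr do rewrite linearZ /= defA !mxE.
rewrite (bigD1 b) //= eqxx andbT big1 ?addr0 => [|k /negPf neq_kb]; last first.
  by rewrite (eq_sym b) neq_kb andbF mulr0.
rewrite (bigD1 j) //= mxE eqxx andbT big1 ?addr0 => [|k /negPf neq_kj].
  by rewrite mulrC.
by rewrite mxE neq_kj andbF mul0r.
Qed.

Lemma char_poly_sim (F : fieldType) n (A B P : 'M[F]_n) :
  P \in unitmx -> A *m P = P *m B -> char_poly A = char_poly B.
Proof.
move=> uP AP; have uPX: map_mx polyC P \in unitmx by rewrite map_unitmx.
have: char_poly_mx A *m map_mx polyC P = map_mx polyC P *m char_poly_mx B.
  by rewrite mulmxBl mulmxBr -scalar_mxC -!map_mxM AP.
move/(congr1 determinant); rewrite !det_mulmx mulrC.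
apply: mulfI; apply: contraTneq uPX; rewrite unitmxE => ->.
by rewrite unitr0.
Qed.

Lemma char_poly_tr (F : fieldType) n (A : 'M[F]_n) :
  char_poly A^T = char_poly A.
Proof.
by rewrite /char_poly -det_tr /char_poly_mx linearB /= tr_scalar_mx map_trmx trmxK.
Qed.

Lemma char_poly_block (F : fieldType) m n (A : 'M[F]_m) (B : 'M[F]_n) :
  char_poly (block_mx A 0 0 B) = char_poly A * char_poly B.
Proof.
rewrite /char_poly /char_poly_mx map_block_mx !map_mx0 (scalar_mx_block m n).
by rewrite opp_block_mx add_block_mx !oppr0 !addr0 det_ublock.
Qed.

Lemma char_poly_rsim (F : fieldType) (gT : finGroupType) (G : {group gT})
    n1 n2 (rG1 : mx_representation F G n1) (rG2 : mx_representation F G n2) :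
  mx_rsim rG1 rG2 -> {in G, forall x, char_poly (rG1 x) = char_poly (rG2 x)}.
Proof.
case=> B eqn; case: _ / eqn => [] in rG2 B *; rewrite row_free_unit => uB homB x Gx.
exact: char_poly_sim uB (homB x Gx).
Qed.

(** * Traces in characteristic 2 *)

Section Pchar2.

Variables (F : fieldType) (ch2 : 2 \in [pchar F]).

(** Off-diagonal terms occur in equal pairs, which cancel. *)
Lemma sum_sym_pchar2 n (f : 'I_n -> 'I_n -> F) :
  (forall i j, f i j = f j i) -> \sum_i \sum_j f i j = \sum_i f i i.
Proof.
elim: n f => [|n IHn] f symf; first by rewrite !big_ord0.
rewrite !big_ord_recr /=.
under eq_bigr do rewrite big_ord_recr /=.
rewrite big_split /= IHn => [|i j]; last exact: symf.
rewrite addrA -(addrA (\sum_(i < n) _)); congr (_ + _).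
rewrite -[RHS]addr0; congr (_ + _).
under [X in _ + X]eq_bigr do rewrite symf.
exact: addrr_pchar2.
Qed.

Lemma sqr_sum_pchar2 I r (P : pred I) (f : I -> F) :
  (\sum_(i <- r | P i) f i) ^+ 2 = \sum_(i <- r | P i) f i ^+ 2.
Proof. exact: (raddf_sum (pFrobenius_aut ch2)). Qed.

Lemma mxtrace_sqr_pchar2 n (A : 'M[F]_n) : \tr (A *m A) = \tr A ^+ 2.
Proof.
rewrite /mxtrace sqr_sum_pchar2.
under eq_bigr do rewrite mxE.
rewrite sum_sym_pchar2 => [|i j]; last exact: mulrC.
by apply: eq_bigr => i _; rewrite expr2.
Qed.

Lemma repr_tr_exp2 (gT : finGroupType) (G : {group gT}) n
    (rG : mx_representation F G n) x k :
  x \in G -> \tr (rG (x ^+ (2 ^ k))%g) = \tr (rG x) ^+ (2 ^ k).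
Proof.
move=> Gx; elim: k => [|k IHk]; first by rewrite expg1 expr1.
rewrite expnSr expgM {1}expgS expg1 repr_mxM ?groupX // mxtrace_sqr_pchar2.
by rewrite IHk exprM.
Qed.

(** If [2 ^ k] is the 2-part of the order of [x], then [x ^+ (2 ^ k)] has odd order and its trace is
    the [2 ^ k]-th power of the trace of [x]. Squaring is injective, so traces at odd order elements
    determine all traces. *)
Lemma abs_irr_rsim_odd_tr (gT : finGroupType) (G : {group gT})
    n1 n2 (rG1 : mx_representation F G n1) (rG2 : mx_representation F G n2) :
    mx_absolutely_irreducible rG1 -> mx_absolutely_irreducible rG2 ->
    (forall x, odd_elt G x -> \tr (rG1 x) = \tr (rG2 x)) ->
  mx_rsim rG1 rG2.
Proof.
move=> abs1 abs2 eq_tr; apply: abs_irr_rsim_tr => // x Gx.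
pose k := logn 2 #[x]%g.
have odd_xk : odd #[x ^+ (2 ^ k)]%g.
  rewrite orderXdiv ?pfactor_dvdnn // -p_part -[X in odd (X %/ _)](partnC 2%N) //.
  by rewrite mulKn // odd_2'nat part_pnat.
have: \tr (rG1 x) ^+ (2 ^ k) = \tr (rG2 x) ^+ (2 ^ k).
  by rewrite -!repr_tr_exp2 // eq_tr // /odd_elt groupX.
elim: k {odd_xk} => // k IHk; rewrite expnSr !exprM => eq_sqr.
exact/IHk/(fmorph_inj (pFrobenius_aut ch2)).
Qed.

End Pchar2.

(** * Brauer characters *)

Section Brauer.

Variables (R : idomainType) (F : fieldType) (rho : {rmorphism R -> F}).
Hypothesis ch2 : 2 \in [pchar F].

(** If [x] and [y] differ, the cofactor of [x - y] in [x ^+ m - y ^+ m] vanishes; when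
    [rho x = rho y] it reduces to [m] times [rho x ^+ m.-1], which is nonzero for odd [m]. *)
Lemma odd_root_inj m : odd m ->
  {in [pred x | x ^+ m == 1] &, injective rho}.
Proof.
move=> odd_m x y /eqP xm /eqP ym eq_rho; apply/eqP; rewrite -subr_eq0.
have m_gt0 : (0 < m)%N by case: m odd_m {xm ym}.
have nz_rho : rho x != 0.
  apply/eqP=> x0; have /eqP := congr1 rho xm.
  by rewrite rmorphXn x0 rmorph1 expr0n eqn0Ngt m_gt0 eq_sym oner_eq0.
have /eqP : (x - y) * (\sum_(i < m) x ^+ (m.-1 - i) * y ^+ i) = 0.
  by rewrite -subrXX xm ym subrr.
rewrite mulf_eq0 => /orP[] // /eqP /(congr1 rho)/eqP.
rewrite rmorph0 rmorph_sum.
under eq_bigr => i _.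
  rewrite rmorphM !rmorphXn -eq_rho -exprD subnK; last by rewrite -ltnS prednK.
  over.
rewrite sumr_const card_ord -mulr_natr mulf_eq0 expf_eq0 (negPf nz_rho) andbF /=.
by rewrite -(dvdn_pcharf ch2) dvdn2 odd_m.
Qed.

Lemma odd_root_sum m (s t : seq R) : odd m ->
    {in s, forall x, x ^+ m = 1} -> {in t, forall x, x ^+ m = 1} ->
    \prod_(x <- s) ('X - (rho x)%:P) = \prod_(x <- t) ('X - (rho x)%:P) ->
  \sum_(x <- s) x = \sum_(x <- t) x.
Proof.
move=> odd_m s1 t1 eq_prod.
have eq_st : perm_eq (map rho s) (map rho t).
  by apply: prod_XsubC_eq; rewrite !big_map.
(* [r] inverts [rho] on the roots that occur, so both sums are sums of [r] over lists that agree up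
   to permutation. *)
pose r y := nth 0 (s ++ t) (index y (map rho (s ++ t))).
have st1 : {in s ++ t, forall x, x ^+ m = 1}.
  by move=> x; rewrite mem_cat => /orP[/s1 | /t1].
have rK : {in s ++ t, cancel rho r}.
  move=> x stx; have rho_x: rho x \in map rho (s ++ t) by apply: map_f.
  have lt_i: (index (rho x) (map rho (s ++ t)) < size (s ++ t))%N.
    by rewrite -(size_map rho) index_mem.
  apply: (odd_root_inj odd_m); rewrite ?inE ?st1 ?mem_nth //.
  by rewrite /r -(nth_map _ 0) // nth_index.
have sumE u : {subset u <= s ++ t} -> \sum_(x <- u) x = \sum_(y <- map rho u) r y.
  by move=> sub_u; rewrite big_map; apply: eq_big_seq => x /sub_u/rK.
rewrite !sumE; first exact: perm_big.
  by move=> x; rewrite mem_cat orbC => ->.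
by move=> x; rewrite mem_cat => ->.
Qed.

Variable gT : finGroupType.
Implicit Type H : {group gT}.

Lemma odd_eltV H x : odd_elt H x^-1%g = odd_elt H x.
Proof. by rewrite /odd_elt groupV orderV. Qed.

Lemma affords_brauer_char_poly H n1 n2 (rH1 : mx_representation F H n1)
    (rH2 : mx_representation F H n2) chi :
    (forall x, odd_elt H x -> char_poly (rH1 x) = char_poly (rH2 x)) ->
  affords_brauer rho rH1 chi -> affords_brauer rho rH2 chi.
Proof.
move=> eq12 aff x; move/(_ x): aff; case: ifP => // Hx [s [s1 cp sum_s]].
by exists s; rewrite -eq12.
Qed.

Lemma affords_brauer_rsim H n1 n2 (rH1 : mx_representation F H n1)
    (rH2 : mx_representation F H n2) chi :
  mx_rsim rH1 rH2 -> affords_brauer rho rH1 chi -> affords_brauer rho rH2 chi.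
Proof.
move=> sim12; apply: affords_brauer_char_poly => x /andP[Hx _].
exact: char_poly_rsim Hx.
Qed.

Lemma affords_brauer_uniq H n (rH : mx_representation F H n) chi1 chi2 :
  affords_brauer rho rH chi1 -> affords_brauer rho rH chi2 -> chi1 = chi2.
Proof.
move=> aff1 aff2; apply/ffunP=> x; move: (aff1 x) (aff2 x).
case: ifP => [/andP[_ odd_x] | _ -> -> //] [s [s1 -> ->]] [t [t1 eq_st ->]].
exact: (odd_root_sum odd_x s1 t1 eq_st).
Qed.

Lemma affords_brauer_tr H n (rH : mx_representation F H n) chi x :
    (0 < n)%N -> affords_brauer rho rH chi -> odd_elt H x ->
  \tr (rH x) = rho (chi x).
Proof.
move=> n_gt0 /(_ x) aff Hx; move: aff; rewrite Hx => -[s [_ cp ->]].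
apply: oppr_inj; rewrite -char_poly_trace // cp rmorph_sum.
have sz: size s = n.
  apply: succn_inj; rewrite -(size_char_poly (rH x)) cp.
  by rewrite (size_prod_XsubC s rho).
rewrite -(big_map rho xpredT (fun z => 'X - z%:P)) -sz -(size_map rho).
by rewrite coefPn_prod_XsubC ?big_map // size_map sz -lt0n.
Qed.

Lemma affords_brauer_irr_rsim H n1 n2 (rH1 : mx_representation F H n1)
    (rH2 : mx_representation F H n2) chi :
    group_splitting_field F H ->
    mx_irreducible rH1 -> mx_irreducible rH2 ->
    affords_brauer rho rH1 chi -> affords_brauer rho rH2 chi ->
  mx_rsim rH1 rH2.
Proof.
move=> splitH irr1 irr2 aff1 aff2.
apply: (abs_irr_rsim_odd_tr ch2); try exact: splitH.
case/mx_irrP: irr1 irr2 => n1_gt0 _ /mx_irrP[n2_gt0 _] x Hx.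
by rewrite (affords_brauer_tr _ aff1) // (affords_brauer_tr _ aff2).
Qed.

(** Divisibility suffices, as a monic divisor of a product of linear factors is a subproduct.
    Submodules of a module with a Brauer character thus get one too, with no appeal to roots of
    unity in [R]. *)
Lemma affords_brauer_exists H n (rH : mx_representation F H n) :
    (forall x, odd_elt H x -> exists s : seq R,
       [/\ forall y, y \in s -> y ^+ #[x]%g = 1
         & char_poly (rH x) %| \prod_(y <- s) ('X - (rho y)%:P)]) ->
  exists chi, affords_brauer rho rH chi.
Proof.
move=> cpH.
have /fin_all_exists[f Pf] (x : gT) : exists c, if odd_elt H x then
    exists s : seq R, [/\ forall y, y \in s -> y ^+ #[x]%g = 1,
     char_poly (rH x) = \prod_(y <- s) ('X - (rho y)%:P) & c = \sum_(y <- s) y]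
  else c = 0.
  have [/cpH[s [s1 dvd_s]] | _] := boolP (odd_elt H x); last by exists 0.
  have [m] := dvdp_prod_XsubC dvd_s.
  rewrite eqp_monic ?char_poly_monic ?monic_prod_XsubC // => /eqP cp.
  exists (\sum_(y <- mask m s) y), (mask m s); split=> // y /mem_mask.
  exact: s1.
exists (finfun f) => x; rewrite ffunE; exact: Pf.
Qed.

Fact dual_mx_repr H n (rH : mx_representation F H n) :
  mx_repr H (fun x => (rH x^-1%g)^T).
Proof.
split=> [|x y Hx Hy]; first by rewrite invg1 repr_mx1 trmx1.
by rewrite invMg repr_mxM ?groupV // trmx_mul.
Qed.
Definition dual_repr H n (rH : mx_representation F H n) :=
  MxRepresentation (dual_mx_repr rH).

Lemma dual_mx_abs_irr H n (rH : mx_representation F H n) :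
  mx_absolutely_irreducible rH -> mx_absolutely_irreducible (dual_repr rH).
Proof.
case/mx_abs_irrP=> n_gt0 [a aE]; apply/mx_abs_irrP; split=> //.
exists (fun x A => a x^-1%g A^T) => A; rewrite -{1}[A]trmxK [A^T in LHS]aE.
rewrite linear_sum (reindex_inj invg_inj) /=.
by apply: eq_big => x; rewrite ?groupV // linearZ.
Qed.

Lemma affords_brauer_dual H n (rH : mx_representation F H n) chi :
  affords_brauer rho rH chi ->
  affords_brauer rho (dual_repr rH) (brauer_dual chi).
Proof.
move=> aff x; rewrite ffunE /= char_poly_tr.
by move/(_ x^-1%g): aff; rewrite odd_eltV orderV.
Qed.

Lemma affords_brauer1 H (rH : mx_representation F H 1) :
  {in H, forall x, rH x = 1%:M} -> affords_brauer rho rH (brauer1 R H).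
Proof.
move=> trivH x; rewrite ffunE; case Hxo: (odd_elt H x) => //.
have /andP[Hx _] := Hxo; exists [:: 1]; rewrite !big_seq1 rmorph1; split=> // [y|].
  by rewrite inE => /eqP->; rewrite expr1n.
by rewrite trivH // char_poly_trig ?scalar_mx_is_trig // big_ord1 mxE eqxx.
Qed.

Lemma affords_brauer_dsum H (I : finType) (P : pred I)
    (rU : I -> representation F H) (chi : I -> {ffun gT -> R}) :
    (forall i, P i -> affords_brauer rho (rU i) (chi i)) ->
  affords_brauer rho (\big[@dadd_grepr F gT H/grepr0]_(i | P i) rU i)
    (\sum_(i | P i) chi i).
Proof.
move=> aff.
apply: (big_ind2 (fun (r : representation F H) (c : {ffun gT -> R}) =>
  affords_brauer rho r c)) => //.
  move=> x; rewrite ffunE; case: ifP => // _; exists [::]; rewrite !big_nil.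
  by split=> //; apply: det_mx00.
move=> r1 c1 r2 c2 aff1 aff2 x; move: (aff1 x) (aff2 x); rewrite ffunE.
case: ifP => [_ | _ -> ->]; last by rewrite addr0.
move=> [s [s1 cps ->]] [t [t1 cpt ->]]; exists (s ++ t); rewrite !big_cat /=.
split=> //; last by rewrite char_poly_block cps cpt.
by move=> y; rewrite mem_cat => /orP[/s1 | /t1].
Qed.

End Brauer.

Lemma char_poly_dsum (F : fieldType) (gT : finGroupType) (H : {group gT})
    (I : finType) (P : pred I) (rU : I -> representation F H) x :
  char_poly ((\big[@dadd_grepr F gT H/grepr0]_(i | P i) rU i) x)
    = \prod_(i | P i) char_poly (rU i x).
Proof.
apply: (big_ind2 (fun (r : representation F H) p => char_poly (r x) = p)).
- exact: det_mx00.
- by move=> r1 _ r2 _ <- <-; apply: char_poly_block.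
by [].
Qed.

(** The restriction of [rG] is a direct sum of translates of [M]. Their characteristic polynomials
    divide those of [rG], so each has a Brauer character, and uniqueness identifies the sum with the
    restriction of [theta]. *)
Lemma Clifford_brauer (R : idomainType) (F : fieldType)
    (rho : {rmorphism R -> F}) (ch2 : 2 \in [pchar F])
    (gT : finGroupType) (G N : {group gT}) (nsNG : (N <| G)%g)
    n (rG : mx_representation F G n) (theta : {ffun gT -> R}) (M : 'M_n)
    (rN := subg_repr rG (normal_sub nsNG)) :
    mx_irreducible rG -> affords_brauer rho rG theta -> mxsimple rN M ->
  exists (X : {set gT}) (phi : gT -> {ffun gT -> R}),
    [/\ X \subset G, (\sum_(x in X) M *m rG x :=: 1%:M)%MS
            /\ mxdirect (\sum_(x in X) M *m rG x),
        forall x (modMx : mxmodule rN (M *m rG x)), x \in X ->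
          affords_brauer rho (submod_repr modMx) (phi x)
      & brauer_res N theta = \sum_(x in X) phi x].
Proof.
move=> irrG aff simM; have [X sXG [sumX dxX]] := Clifford_basis irrG simM.
(* The default [M] outside [G] makes [U x] a submodule for every [x], so that [rU] can be a total
   function. *)
pose U x := if x \in G then M *m rG x else M.
have modU x : mxmodule rN (U x).
  rewrite /U; case: ifP => [Gx | _]; last by case: simM.
  by have [] := Clifford_simple simM Gx.
have UX x : x \in X -> U x = M *m rG x by move/(subsetP sXG); rewrite /U => ->.
have sumU : (\sum_(x in X) U x :=: 1%:M)%MS by rewrite (eq_bigr _ UX).
have dxU : mxdirect (\sum_(x in X) U x).
  move: dxX; rewrite !mxdirectE /= (eq_bigr _ UX) => /eqP->.
  by apply/eqP/eq_bigr => x /UX->.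
pose rU x : representation F N := Representation (submod_repr (modU x)).
have simU := mx_rsim_dsum (mxmodule1 rN) sumU dxU (fun x => mx_rsim_refl (rU x)).
have simN := mx_rsim_trans (mx_rsim_sym simU) (rsim_submod1 _ (eqmx_refl _)).
set rS := mx_repr_of_repr _ in simN.
have cpS y : y \in N -> \prod_(x in X) char_poly (rU x y) = char_poly (rG y).
  by move=> Ny; rewrite -char_poly_dsum (char_poly_rsim simN Ny).
have oddN y : odd_elt N y -> odd_elt G y.
  by rewrite /odd_elt => /andP[/(subsetP (normal_sub nsNG))-> ->].
have /fin_all_exists[phi affX] x :
    exists c, x \in X -> affords_brauer rho (rU x) c.
  have [Xx | _] := boolP (x \in X); last by exists 0.
  have [y Ny|c affc] := @affords_brauer_exists _ _ rho _ _ _ (rU x); last by exists c.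
  move: (aff y); rewrite oddN // => -[s [s1 cps _]]; exists s; split=> //.
  rewrite -cps -cpS; last by case/andP: Ny.
  by rewrite (bigD1 x) //= dvdp_mulr.
exists X, phi; split=> // [x modMx Xx|].
  move: (affX x Xx); rewrite /rU /=; move: (modU x); rewrite (UX x Xx) => modU'.
  by rewrite (bool_irrelevance modU' modMx).
have affN : affords_brauer rho rN (brauer_res N theta).
  move=> y; rewrite ffunE; case Ny: (odd_elt N y); last first.
    case: ifP => // Ny'; move: (aff y); rewrite /odd_elt.
    by move: Ny; rewrite /odd_elt Ny' /= => ->; rewrite andbF.
  by move: (aff y); rewrite oddN //; case/andP: Ny => ->.
apply: (affords_brauer_uniq ch2 affN).
exact/(affords_brauer_rsim simN)/affords_brauer_dsum.
Qed.

(** * Invariant forms and the Frobenius twist *)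

Lemma irr_hom_simple (F : fieldType) (gT : finGroupType) (H : {group gT})
    n1 n2 (r1 : mx_representation F H n1) (r2 : mx_representation F H n2)
    (B : 'M_(n1, n2)) :
    mx_irreducible r1 -> B != 0 ->
    (forall x, x \in H -> r1 x *m B = B *m r2 x) ->
  mxsimple r2 <<B>>%MS.
Proof.
move=> irr1 nzB homB; have freeB := irr_hom_free irr1 nzB homB.
have [_ min1] := (mx_irrP _).1 irr1; have [B' BK] := row_freeP freeB.
split=> [||U modU sUB nzU].
- rewrite (eqmx_module _ (genmxE B)); apply/mxmoduleP=> x Hx.
  by rewrite -homB // submxMl.
- by rewrite (eqmx_eq0 (genmxE B)).
move: sUB; rewrite !genmxE => /submxP[D defU].
(* [D] is the preimage of [U] under the injective map [B]; a right inverse of [B] shows that it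
   spans a submodule of [r1]. *)
have fullD : row_full <<D>>%MS.
  apply: min1; last first.
    by rewrite (eqmx_eq0 (genmxE D)); apply: contraNneq nzU => D0; rewrite defU D0 mul0mx.
  rewrite (eqmx_module _ (genmxE D)); apply/mxmoduleP=> x Hx.
  have /submxP[E defE] := mxmoduleP modU x Hx.
  rewrite -[D in X in (X <= _)%MS]mulmx1 -mulmxA -[r1 x]mulmx1 -BK !mulmxA.
  rewrite -(mulmxA _ (r1 x)) homB // !mulmxA -(mulmxA D) BK mulmx1 -defU defE.
  by rewrite defU !mulmxA -mulmxA BK mulmx1 submxMl.
by rewrite defU -[X in (X <= _)%MS]mul1mx submxMr // sub1mx /row_full -genmxE.
Qed.

Section InvariantForm.

Variables (F : fieldType) (gT : finGroupType) (H : {group gT}) (n : nat).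
Variable rH : mx_representation F H n.

Definition inv_form (B : 'M_n) :=
  forall x, x \in H -> rH x *m B *m (rH x)^T = B.

(** Read as an intertwiner from the module to its dual, an invariant form falls under Schur's
    lemma. *)
Lemma inv_formP (B : 'M_n) :
  inv_form B <-> (forall x, x \in H -> rH x *m B = B *m (rH x^-1%g)^T).
Proof.
split=> invB x Hx.
  rewrite -{2}(invB x Hx) -mulmxA -trmx_mul -repr_mxM ?groupV // mulVg.
  by rewrite repr_mx1 trmx1 mulmx1.
rewrite invB // -mulmxA -trmx_mul -repr_mxM ?groupV // mulgV.
by rewrite repr_mx1 trmx1 mulmx1.
Qed.

Lemma inv_form_unit (B : 'M_n) :
  mx_irreducible rH -> inv_form B -> B != 0 -> B \in unitmx.
Proof.
move=> irrH /inv_formP homB nzB; rewrite -row_free_unit.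
exact: irr_hom_free irrH nzB homB.
Qed.

(** [C *m invmx B] is an endomorphism of an absolutely irreducible module, hence scalar. *)
Lemma inv_form_scalar (B C : 'M_n) :
    mx_absolutely_irreducible rH -> inv_form B -> B \in unitmx -> inv_form C ->
  exists c, C = c *: B.
Proof.
move=> absH /inv_formP homB uB /inv_formP homC.
have /is_scalar_mxP[c defc] : is_scalar_mx (C *m invmx B).
  apply: (mx_abs_irr_cent_scalar absH); apply/centgmxP=> x Hx.
  rewrite -mulmxA [RHS]mulmxA homC // -[RHS]mulmxA; congr (C *m _).
  by rewrite -[LHS](mulmxK uB) -(mulmxA _ (rH x)) homB // mulKmx.
by exists c; rewrite -mul_scalar_mx -defc mulmxKV.
Qed.

End InvariantForm.

Section Twist.

Variables (F : fieldType) (ch2 : 2 \in [pchar F]).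
Local Notation frob := (pFrobenius_aut ch2).
Local Notation "A ^f" := (map_mx frob A) : ring_scope.

(** These maps are the linear forms on the Frobenius twist, evaluated at vectors [v^f]. *)
Definition sqr_linear n (h : 'rV[F]_n -> F) :=
  (forall u v, h (u + v) = h u + h v) /\ (forall a v, h (a *: v) = a ^+ 2 * h v).

Lemma sqr_linearE n (h : 'rV[F]_n -> F) : sqr_linear h ->
  forall v, h v = (v^f *m \col_i h (delta_mx 0 i)) 0 0.
Proof.
move=> [hD hZ] v; rewrite {1}[v]row_sum_delta mxE.
have h0 : h 0 = 0 by rewrite -(scale0r 0) hZ expr2 !mul0r.
rewrite (big_morph h hD h0); apply: eq_bigr => i _.
by rewrite hZ !mxE pFrobenius_autE.
Qed.

(** [F] need not be perfect, so not every row is some [v^f]; the standard basis vectors are, and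
    they suffice. *)
Lemma twist_row_inj m n (A B : 'M[F]_(m, n)) :
  (forall v : 'rV_m, v^f *m A = v^f *m B) -> A = B.
Proof.
move=> eqAB; apply/row_matrixP=> i; move: (eqAB (delta_mx 0 i)).
by rewrite map_delta_mx -!rowE.
Qed.

(** For symmetric [B] the map [v -> v B v^T] is additive in characteristic 2; the diagonal of [B] is
    its coordinate column as a linear form on the twist. *)
Lemma diag_congr_pchar2 m n (A : 'M[F]_(m, n)) (B : 'M_n) : B^T = B ->
  \col_i (A *m B *m A^T) i i = A^f *m \col_i B i i.
Proof.
move=> symB; apply/colP=> i; rewrite !mxE.
under eq_bigr do rewrite !mxE mulr_suml.
rewrite (sum_sym_pchar2 ch2) => [|j k]; last first.
  by rewrite -{1}symB mxE mulrAC [A i _ * A i _]mulrC mulrAC.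
by apply: eq_bigr => j _; rewrite !mxE pFrobenius_autE expr2 mulrAC.
Qed.

Variables (gT : finGroupType) (G N : {group gT}) (sNG : N \subset G) (d : nat).
Variables (rG : mx_representation F G d) (B : 'M[F]_d).
Hypotheses (fixN : rfix_mx rG N = 0) (uB : B \in unitmx) (invB : inv_form rG B).
Local Notation rGf := (map_repr frob rG).

(** [B^f] identifies the twist with its dual and carries [u] to a fixed vector of the twist. Fixed
    spaces commute with the field morphism [frob], so this vector is zero by [fixN]. *)
Lemma twist_cofix0 (u : 'cV_d) :
  (forall x, x \in N -> (rG x)^f *m u = u) -> u = 0.
Proof.
move=> fixu; have uBf : B^f \in unitmx by rewrite map_unitmx.
suff: (u^T *m invmx B^f <= rfix_mx rGf N)%MS.
  rewrite -map_rfix_mx fixN map_mx0 submx0 => /eqP u0.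
  by apply: trmx_inj; rewrite trmx0 -[u^T](mulmxKV uBf) u0 mul0mx.
apply/rfix_mxP=> x Nx; have Gx := subsetP sNG x Nx.
have homB : rGf x *m B^f = B^f *m (rGf x^-1%g)^T.
  by rewrite /map_repr /= /map_repr_mx matrix.map_trmx -!map_mxM ((inv_formP _ _).1 invB).
rewrite -(mulmxA u^T); have ->: invmx B^f *m rGf x = (rGf x^-1%g)^T *m invmx B^f.
  by rewrite -[LHS](mulmxK uBf) -(mulmxA _ (rGf x)) homB mulKmx.
by rewrite mulmxA -trmx_mul fixu // groupV.
Qed.

End Twist.

(** * The cocycle of a quadratic form with polar form [B] *)

Section NonQuadratic.

Variables (F : fieldType) (ch2 : 2 \in [pchar F]).
Local Notation frob := (pFrobenius_aut ch2).
Local Notation "A ^f" := (map_mx frob A) : ring_scope.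
Variables (gT : finGroupType) (G N : {group gT}) (nsNG : (N <| G)%g) (d : nat).
Variables (rG : mx_representation F G d) (B : 'M[F]_d).
Hypotheses (absG : mx_absolutely_irreducible rG) (fixN : rfix_mx rG N = 0).
Hypotheses (uB : B \in unitmx) (invB : inv_form rG B).
Let sNG := normal_sub nsNG.
Let cofix0 := twist_cofix0 (ch2 := ch2) sNG fixN uB invB.

(** [B^T] is a multiple [c *: B]; transposing twice gives [c ^+ 2 = 1], and 1 is the only square
    root of 1 here. *)
Lemma inv_form_sym : B^T = B.
Proof.
have [|c defB] := inv_form_scalar absG invB uB (C := B^T).
  by move=> x Gx; rewrite -[in RHS](invB Gx) !trmx_mul trmxK mulmxA.
have d_gt0 : (0 < d)%N by case/andP: absG.
have nzB : B != 0.
  by apply: contraTneq uB => ->; rewrite -row_free_unit /row_free mxrank0 eq_sym -lt0n.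
suff c1 : c = 1 by rewrite defB c1 scale1r.
have: (c ^+ 2 - 1) *: B = 0.
  by rewrite scalerBl scale1r -[X in _ - X]trmxK defB linearZ /= defB scalerA subrr.
move/eqP; rewrite scaler_eq0 (negPf nzB) orbF subr_eq0 => /eqP c2.
by apply: (fmorph_inj frob); rewrite rmorph1.
Qed.

Lemma inv_form_alt i : B i i = 0.
Proof.
have /colP/(_ i) : \col_i B i i = 0; last by rewrite !mxE.
apply: cofix0 => x Nx; rewrite -(diag_congr_pchar2 ch2 _ inv_form_sym).
by rewrite invB ?(subsetP sNG).
Qed.

(** Halving [B] is impossible in characteristic 2, so its strict upper triangle supplies the
    quadratic form; the zero diagonal makes [B] its polar form. *)
Definition upper_form : 'M[F]_d := \matrix_(i, j) if (i < j)%N then B i j else 0.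
Definition base_quad (v : 'rV_d) := (v *m upper_form *m v^T) 0 0.

Lemma upper_formD : upper_form + upper_form^T = B.
Proof.
apply/matrixP=> i j; rewrite !mxE.
case: ltngtP => [_|_|/val_inj ->]; rewrite ?addr0 ?add0r ?inv_form_alt //.
by rewrite -[in RHS]inv_form_sym mxE.
Qed.

Lemma base_quadD u v :
  base_quad (u + v) = base_quad u + base_quad v + (u *m B *m v^T) 0 0.
Proof.
rewrite /base_quad linearD /= !mulmxDl !mulmxDr -upper_formD mulmxDr mulmxDl !mxE.
set a := \sum_j _; set b := \sum_j _; set c := \sum_j _; set e := \sum_j _.
suff ->: \sum_j (u *m upper_form^T) 0 j * v^T j 0 = c by ring.
transitivity ((u *m upper_form^T *m v^T)^T 0 0); first by rewrite !mxE.
by rewrite !trmx_mul !trmxK mulmxA mxE.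
Qed.

Lemma base_quadZ a v : base_quad (a *: v) = a ^+ 2 * base_quad v.
Proof.
by rewrite /base_quad linearZ -!scalemxAl -scalemxAr scalerA mxE expr2.
Qed.

(** Coordinates of [v -> base_quad (v g) - base_quad v] in the dual of the twist. Both terms have
    polar form [B], so the difference is a linear form on the twist. *)
Definition quad_cocycle g :=
  \col_i (base_quad (delta_mx 0 i *m rG g) - base_quad (delta_mx 0 i)).

Lemma base_quadJ g v : g \in G ->
  base_quad (v *m rG g) = base_quad v + (v^f *m quad_cocycle g) 0 0.
Proof.
move=> Gg; apply/eqP; rewrite addrC -subr_eq; apply/eqP.
apply: (@sqr_linearE _ ch2 _ (fun v => base_quad (v *m rG g) - base_quad v)).
split=> [u w | a w].
  rewrite mulmxDl !base_quadD trmx_mul !mulmxA -(mulmxA u (rG g)).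
  rewrite -(mulmxA u (rG g *m B)) invB //.
  by ring.
by rewrite -scalemxAl !base_quadZ mulrBr.
Qed.

Lemma quad_cocycleM g h : g \in G -> h \in G ->
  quad_cocycle (g * h)%g = (rG g)^f *m quad_cocycle h + quad_cocycle g.
Proof.
move=> Gg Gh; apply: (twist_row_inj (ch2 := ch2)) => v; apply/rowP=> j; rewrite ord1.
apply: (addrI (base_quad v)); rewrite -base_quadJ ?groupM // repr_mxM // mulmxA.
rewrite !base_quadJ //.
rewrite mulmxDr mulmxA -map_mxM [X in _ = _ + X]mxE. ring.
Qed.

(** Correcting [base_quad] by [mu] makes it invariant under [N]. For [g] in [G], normality of [N]
    makes the change of the corrected form under [g] an [N]-fixed linear form on the twist, hence
    zero by [cofix0]. *)
Lemma splitting_quadratic (mu : 'cV_d) :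
    (forall x, x \in N -> quad_cocycle x + mu = (rG x)^f *m mu) ->
  has_invariant_quadratic_form rG.
Proof.
move=> splitN.
have splitG g : g \in G -> quad_cocycle g + mu = (rG g)^f *m mu.
  move=> Gg; apply/eqP; rewrite -subr_eq0; apply/eqP/cofix0 => x Nx.
  have Gx := subsetP sNG x Nx.
  have Ny : (x ^ g)%g \in N by rewrite memJ_norm // (subsetP (normal_norm nsNG)).
  have Gy := subsetP sNG _ Ny.
  have e_mu : (rG x)^f *m ((rG g)^f *m mu)
      = (rG g)^f *m quad_cocycle (x ^ g)%g + (rG g)^f *m mu.
    rewrite mulmxA -map_mxM -repr_mxM // conjgC repr_mxM // map_mxM -mulmxA.
    by rewrite -(splitN _ Ny) mulmxDr.
  have e_lam : (rG x)^f *m quad_cocycle g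
      = (rG g)^f *m quad_cocycle (x ^ g)%g + quad_cocycle g - quad_cocycle x.
    by rewrite -quad_cocycleM // -conjgC quad_cocycleM // addrK.
  rewrite mulmxBr mulmxDr e_mu e_lam -(splitN _ Nx).
  apply/colP=> i; rewrite !mxE; ring.
pose Q v := base_quad v - (v^f *m mu) 0 0.
have QD u v : Q (u + v) - Q u - Q v = (u *m B *m v^T) 0 0.
  have muD : ((u + v)^f *m mu) 0 0 = (u^f *m mu) 0 0 + (v^f *m mu) 0 0.
    by rewrite map_mxD mulmxDl mxE.
  by rewrite /Q base_quadD muD; ring.
exists Q; split.
- split=> [a v | u a v w].
    by rewrite /Q base_quadZ map_mxZ -scalemxAl [X in _ - X]mxE mulrBr.
  by rewrite !QD linearP mulmxDr /= -scalemxAr !mxE.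
(* The polar form is nonzero at some pair of basis vectors, so [Q] is nonzero at one of them or at
   their sum. *)
- have /matrix0Pn[i [j nzB]] : B != 0.
    apply: contraTneq uB => ->; case/andP: absG => d_gt0 _.
    by rewrite -row_free_unit /row_free mxrank0 eq_sym -lt0n.
  have: Q (delta_mx 0 i + delta_mx 0 j) - Q (delta_mx 0 i) - Q (delta_mx 0 j) != 0.
    rewrite QD -rowE mxE (bigD1 j) //= big1 ?addr0 => [|k /negPf neq_k].
      by rewrite !mxE !eqxx mulr1.
    by rewrite !mxE neq_k mulr0.
  have [-> | ] := eqVneq (Q (delta_mx 0 i)) 0; last by exists (delta_mx 0 i).
  have [-> | ] := eqVneq (Q (delta_mx 0 j)) 0; last by exists (delta_mx 0 j).
  by rewrite !subr0; exists (delta_mx 0 i + delta_mx 0 j).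
move=> g v Gg; rewrite /Q base_quadJ // map_mxM -mulmxA -splitG // mulmxDr.
by rewrite [X in _ - X = _]mxE; ring.
Qed.

Hypothesis noQ : ~ has_invariant_quadratic_form rG.

(* A pair (y, eta) with these properties is a copy of r in the extension of
   the twist of rG by the trivial module whose cocycle is quad_cocycle.  Its
   translates by G span a complement to the trivial submodule. *)
Lemma nonsplit_sub k (r : mx_representation F N k) (y : 'M_(k, d)) (eta : 'cV_k) :
    mx_irreducible r ->
    (forall x, x \in N -> r x *m y = y *m (rG x)^f) ->
    (forall x, x \in N -> r x *m eta = eta + y *m quad_cocycle x) ->
  y = 0.
Proof.
move=> irr_r homy cocy; apply/eqP/negPn/negP => nzy; apply: noQ.
pose rGf := map_repr frob rG.
have absGf : mx_absolutely_irreducible rGf by rewrite map_mx_abs_irr.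
have simy : mxsimple (subg_repr rGf sNG) <<y>>%MS.
  exact: (irr_hom_simple (r2 := subg_repr rGf sNG) irr_r nzy homy).
have [X sXG [sumX dxX]] := Clifford_basis (mx_abs_irrW absGf) simy.
have [y' yK] := row_freeP (irr_hom_free irr_r nzy homy).
pose A x := <<y>>%MS *m rGf x.
pose p x := proj_mx (A x) (\sum_(z in X | z != x) A z)%MS.
(* On the summand [A x], undo [x] and [y] to reach coordinates in [r], then apply the value that the
   translate by [x] of the lift [(y, eta)] prescribes. *)
pose c x := rGf x^-1%g *m y' *m (y *m quad_cocycle x + eta).
pose mu := \sum_(x in X) p x *m c x.
have muE x : x \in X -> y *m rGf x *m mu = y *m quad_cocycle x + eta.
  move=> Xx; have Gx := subsetP sXG x Xx.
  have yA : (y *m rGf x <= A x)%MS by rewrite submxMr // genmxE.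
  have dxA z := mxdirect_sumsP dxX z.
  rewrite mulmx_sumr (bigD1 x) //= big1 ?addr0 => [|z /andP[Xz neq_zx]].
    rewrite mulmxA proj_mx_id ?dxA // /c -!mulmxA (mulmxA (rGf x)) -repr_mxM ?groupV //.
    by rewrite mulgV repr_mx1 mul1mx mulmxA yK mul1mx.
  rewrite mulmxA proj_mx_0 ?dxA ?mul0mx //.
  by apply: submx_trans yA _; rewrite (sumsmx_sup x) // Xx eq_sym.
apply: (@splitting_quadratic mu) => n Nn; have Gn := subsetP sNG n Nn.
apply/eqP; rewrite -subr_eq0; set dl := _ - _.
suff: (\sum_(x in X) A x <= kermx dl)%MS.
  by rewrite sumX => /sub_kermxP; rewrite mul1mx => ->.
apply/sumsmx_subP=> x Xx; have Gx := subsetP sXG x Xx.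
apply/sub_kermxP.
have /submxP[D ->] : (A x <= y *m rGf x)%MS by rewrite submxMr // genmxE.
have Nm : (n ^ x^-1)%g \in N by rewrite memJ_norm // groupV (subsetP (normal_norm nsNG)).
have Gm := subsetP sNG _ Nm.
have defxn : (x * n = n ^ x^-1 * x)%g by rewrite conjgE invgK !mulgA mulgKV.
rewrite -mulmxA; apply/eqP; rewrite [X in D *m X](_ : _ = 0) ?mulmx0 //.
rewrite /dl mulmxBr mulmxDr muE //.
(* Since [x n = (n ^ x^-1) x], [n] acts on the summand at [x] as the conjugate element of [N] acts
   through [r], where [cocy] applies. *)
have -> : y *m rGf x *m ((rG n)^f *m mu) = r (n ^ x^-1)%g *m (y *m quad_cocycle x + eta).
  rewrite -muE // !mulmxA homy // -(mulmxA y) -(mulmxA y (rGf _)) -!repr_mxM //.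
  by rewrite defxn.
rewrite mulmxDr cocy // mulmxA homy // -!mulmxA.
have -> : rGf x *m quad_cocycle n
    = (rG (n ^ x^-1)%g)^f *m quad_cocycle x + quad_cocycle (n ^ x^-1)%g - quad_cocycle x.
  by rewrite -quad_cocycleM // -defxn quad_cocycleM // addrK.
rewrite !mulmxBr !mulmxDr; apply/matrixP=> i j; rewrite !mxE; ring.
Qed.

(** The polar form of [h] is twice a form, hence zero, so [h] is a linear form on the twist of [rW].
    As [Q] is invariant, [h] lifts [s1 *: w1^f + s2 *: w2^f] to the extension, and [nonsplit_sub]
    kills it. The scalars and [Q] allow a single treatment of isotropic, isomorphic and quadratic
    submodules. *)
Lemma nonquadratic_relation k (rW : mx_representation F N k)
    (w1 w2 : 'M_(k, d)) s1 s2 (Q : 'rV[F]_k -> F) :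
    mx_absolutely_irreducible rW ->
    (forall x, x \in N -> rW x *m w1 = w1 *m rG x) ->
    (forall x, x \in N -> rW x *m w2 = w2 *m rG x) ->
    (forall (a : F) (v : 'rV[F]_k), Q (a *: v) = a ^+ 2 * Q v) ->
    (forall u v : 'rV[F]_k, Q (u + v) = Q u + Q v
       + (u *m (s1 *: (w1 *m B *m w1^T) + s2 *: (w2 *m B *m w2^T)) *m v^T) 0 0) ->
    (forall x v, x \in N -> Q (v *m rW x) = Q v) ->
  s1 *: w1^f + s2 *: w2^f = 0.
Proof.
move=> absW hom1 hom2 QZ QD QN.
pose h v := Q v + s1 * base_quad (v *m w1) + s2 * base_quad (v *m w2).
have slh : sqr_linear h.
  split=> [u v | a v]; last by rewrite /h QZ -!scalemxAl !base_quadZ; ring.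
  have formE (w : 'M_(k, d)) : (u *m (w *m B *m w^T) *m v^T) 0 0
      = (u *m w *m B *m (v *m w)^T) 0 0 by rewrite trmx_mul !mulmxA.
  have -> : h (u + v) = h u + h v
      + ((u *m (s1 *: (w1 *m B *m w1^T) + s2 *: (w2 *m B *m w2^T)) *m v^T) 0 0
      + (u *m (s1 *: (w1 *m B *m w1^T) + s2 *: (w2 *m B *m w2^T)) *m v^T) 0 0).
    rewrite /h QD !mulmxDl !base_quadD -!formE.
    have -> : (u *m (s1 *: (w1 *m B *m w1^T) + s2 *: (w2 *m B *m w2^T)) *m v^T) 0 0
       = s1 * (u *m (w1 *m B *m w1^T) *m v^T) 0 0
         + s2 * (u *m (w2 *m B *m w2^T) *m v^T) 0 0.
      rewrite mulmxDr mulmxDl -!scalemxAr -!scalemxAl mxE.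
      by rewrite [X in X + _]mxE [X in _ + X]mxE.
    by ring.
  by rewrite (addrr_pchar2 ch2) addr0.
have absWf : mx_absolutely_irreducible (map_repr frob rW) by rewrite map_mx_abs_irr.
apply: (nonsplit_sub (mx_abs_irrW absWf) (eta := \col_i h (delta_mx 0 i))) => x Nx.
  rewrite mulmxDr mulmxDl -!scalemxAr -!scalemxAl /map_repr /= /map_repr_mx.
  by rewrite -!map_mxM hom1 // hom2.
have Gx := subsetP sNG x Nx.
apply: (twist_row_inj (ch2 := ch2)) => v; apply/rowP=> j; rewrite ord1.
rewrite mulmxDr [RHS]mxE -(sqr_linearE ch2 slh) mulmxA -map_mxM -(sqr_linearE ch2 slh).
rewrite /h QN // -!(mulmxA v) hom1 // hom2 // !mulmxA !base_quadJ // !map_mxM.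
rewrite mulmxDr mulmxDl -!scalemxAr -!scalemxAl [X in _ = _ + X]mxE.
by rewrite [X in _ = _ + (X + _)]mxE [X in _ = _ + (_ + X)]mxE; ring.
Qed.

(** * Simple [N]-modules inside the module of [theta] *)

Section Submodule.

Variables (k : nat) (rW : mx_representation F N k).
Hypothesis absW : mx_absolutely_irreducible rW.
Implicit Type w : 'M[F]_(k, d).
Local Notation homW w := (forall x, x \in N -> rW x *m w = w *m rG x).

Lemma sub_inv_form w : homW w -> inv_form rW (w *m B *m w^T).
Proof.
move=> homw x Nx; rewrite !mulmxA homw // -!mulmxA -trmx_mul homw // trmx_mul.
by rewrite !mulmxA -(mulmxA w (rG x)) -(mulmxA w (rG x *m B)) invB ?(subsetP sNG).
Qed.

Lemma nonquadratic_relation0 w1 w2 s1 s2 : homW w1 -> homW w2 ->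
    s1 *: (w1 *m B *m w1^T) + s2 *: (w2 *m B *m w2^T) = 0 ->
  s1 *: w1^f + s2 *: w2^f = 0.
Proof.
move=> hom1 hom2 e0.
apply: (nonquadratic_relation (Q := fun=> 0) absW hom1 hom2) => // [a v|u v].
  by rewrite mulr0.
by rewrite e0 mulmx0 mul0mx mxE !addr0.
Qed.

(** If the pulled back form were zero, the relation with coefficients 1 and 0 would give [w^f = 0].
    A nonzero invariant form on an irreducible module is nondegenerate. *)
Lemma sub_form_unit w : homW w -> w != 0 -> w *m B *m w^T \in unitmx.
Proof.
move=> homw nzw; apply: (inv_form_unit (mx_abs_irrW absW) (sub_inv_form homw)).
apply: contraNneq nzw => C0; rewrite -(map_mx_eq0 frob).
have := @nonquadratic_relation0 w w 1 0 homw homw.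
by rewrite C0 !scaler0 addr0 scale1r scale0r addr0 => ->.
Qed.

(** The two pulled back forms are proportional, with ratio [c], so the relation gives
    [w2^f = c *: w1^f]. The inclusion of row spaces descends along [frob] without a square root of
    [c]. *)
Lemma sub_mult_free w1 w2 : homW w1 -> homW w2 -> w1 != 0 -> (w2 <= w1)%MS.
Proof.
move=> hom1 hom2 nz1.
have [c defC] := inv_form_scalar absW (sub_inv_form hom1) (sub_form_unit hom1 nz1)
  (sub_inv_form hom2).
have := @nonquadratic_relation0 w1 w2 (- c) 1 hom1 hom2.
rewrite defC scale1r scaleNr addNr => /(_ erefl)/eqP.
rewrite scale1r scaleNr addrC subr_eq0 -(map_submx frob) => /eqP->.
by rewrite scalemx_sub.
Qed.

(** The polar form of [Q] is [c] times the pulled back form, and the relation with coefficients [c]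
    and 0 forces [c = 0]. Then [Q] is an [N]-fixed linear form on the twist of [rW], hence zero. *)
Lemma sub_nonquadratic w : homW w -> w != 0 -> ~ has_invariant_quadratic_form rW.
Proof.
move=> homw nzw [Q [[QZ Qpolar] [v0 nzQ] QN]].
have uC := sub_form_unit homw nzw; have invC := sub_inv_form homw.
pose P u v := Q (u + v) - Q u - Q v.
have PC (u v : 'rV_k) : P u v = P v u by rewrite /P (addrC u) addrAC.
pose D := \matrix_(i, j) P (delta_mx 0 i) (delta_mx 0 j).
have PD u v : P u v = (u *m D *m v^T) 0 0.
  have PrD u' a b : P u' (a + b) = P u' a + P u' b.
    by have := Qpolar u' 1 a b; rewrite scale1r mul1r.
  have P0 u' : P u' 0 = 0.
    by apply: (addrI (P u' 0)); rewrite -PrD !addr0.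
  have PrZ u' a b : P u' (a *: b) = a * P u' b.
    by have := Qpolar u' a b 0; rewrite addr0 -!/(P _ _) P0 addr0.
  have Pr u' v' : P u' v' = \sum_j v' 0 j * P u' (delta_mx 0 j).
    rewrite {1}[v']row_sum_delta (big_morph (P u') (PrD u') (P0 u')).
    by apply: eq_bigr => j _; rewrite PrZ.
  rewrite Pr mxE; apply: eq_bigr => j _; rewrite !mxE mulrC PC Pr; congr (_ * _).
  by apply: eq_bigr => i _; rewrite !mxE PC.
have invD : inv_form rW D.
  move=> x Nx; apply/matrixP=> i j.
  have entry (A : 'M[F]_k) :
    A i j = ((delta_mx 0 i : 'rV_k) *m A *m (delta_mx 0 j : 'rV_k)^T) 0 0.
    by rewrite -rowE trmx_delta -colE !mxE.
  rewrite !entry !mulmxA -mulmxA -trmx_mul -!PD.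
  by rewrite /P -mulmxDl !QN.
have [c defD] := inv_form_scalar absW invC uC invD.
have c0 : c = 0.
  apply/eqP; have := nonquadratic_relation (s1 := c) (s2 := 0) absW homw homw QZ _ QN.
  rewrite !scale0r !addr0 -defD => rel; have/eqP: c *: w^f = 0.
    apply: rel => u v; rewrite -PD /P; ring.
  by rewrite scaler_eq0 map_mx_eq0 (negPf nzw) orbF.
have slQ : sqr_linear Q.
  split=> // u v; apply/eqP; rewrite -subr_eq0 opprD addrA -/(P u v) PD defD c0.
  by rewrite scale0r mulmx0 mul0mx mxE.
have fixW : rfix_mx rW N = 0.
  have freew := irr_hom_free (mx_abs_irrW absW) nzw homw.
  apply: (row_free_inj freew); rewrite mul0mx; apply/eqP; rewrite -submx0 -fixN.
  by apply/rfix_mxP=> x Nx; rewrite -mulmxA -homw // mulmxA rfix_mx_id.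
have eta0 : \col_i Q (delta_mx 0 i) = 0.
  apply: (twist_cofix0 (ch2 := ch2) (subxx N) fixW uC invC) => x Nx.
  apply: (twist_row_inj (ch2 := ch2)) => v; apply/rowP=> j; rewrite ord1.
  by rewrite mulmxA -map_mxM -!(sqr_linearE ch2 slQ) QN.
by move: nzQ; rewrite (sqr_linearE ch2 slQ) eta0 mulmx0 mxE eqxx.
Qed.

End Submodule.

End NonQuadratic.

Lemma has_invariant_quadratic_form_rsim (F : fieldType) (gT : finGroupType)
    (H : {group gT}) n1 n2 (r1 : mx_representation F H n1)
    (r2 : mx_representation F H n2) :
    mx_rsim r1 r2 ->
  has_invariant_quadratic_form r1 -> has_invariant_quadratic_form r2.
Proof.
case=> B eqn; case: _ / eqn => [] in r2 B *; rewrite row_free_unit => uB homB.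
case=> Q [[QZ Qpolar] [v nzQ] QN]; exists (fun u => Q (u *m invmx B)); split.
- split=> [a u | u a x y]; first by rewrite -scalemxAl QZ.
  by rewrite !mulmxDl -scalemxAl Qpolar.
- by exists (v *m B); rewrite mulmxK.
move=> x u Hx; rewrite -[RHS](QN x) //; congr (Q _); rewrite -!mulmxA; congr (u *m _).
by rewrite -[RHS](mulmxK uB) -(mulmxA _ (r1 x)) homB // mulKmx.
Qed.

Lemma hom_rsim_submod (F : fieldType) (gT : finGroupType) (H : {group gT})
    k n (r : mx_representation F H k) (rH : mx_representation F H n)
    (y : 'M_(k, n)) (M : 'M_n) (modM : mxmodule rH M) :
    row_free y -> (y :=: M)%MS -> (forall x, x \in H -> r x *m y = y *m rH x) ->
  mx_rsim r (submod_repr modM).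
Proof.
move=> freey defM homy; have sym : (y <= M)%MS by rewrite defM.
exists (in_submod M y) => [||x Hx].
- by rewrite -defM (eqP freey).
- by rewrite /row_free mxrank_in_submod.
by rewrite -in_submodJ // -homy // in_submodE mulmxA -in_submodE.
Qed.

Lemma submod_homE (F : fieldType) (gT : finGroupType) (H : {group gT})
    n (rH : mx_representation F H n) (M : 'M_n) (modM : mxmodule rH M) x :
    x \in H ->
  submod_repr modM x *m val_submod 1%:M = val_submod 1%:M *m rH x.
Proof. by move=> Hx; rewrite -val_submodJ // mul1mx -val_submodE. Qed.

(** * Clifford constituents *)

Fact triv_mx_repr (F : fieldType) (gT : finGroupType) (H : {group gT}) :
  mx_repr H (fun=> 1%:M : 'M[F]_1).
Proof. by split=> // x y _ _; rewrite mulmx1. Qed.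
Definition triv_repr F gT H := MxRepresentation (@triv_mx_repr F gT H).

(** [mxsimple_exists] gives existence only under [classically]; excluded middle turns it into a
    plain existential. *)
Lemma mxsimple_inhabited (F : fieldType) (gT : finGroupType) (H : {group gT})
    n (rH : mx_representation F H n) :
  (0 < n)%N -> exists M, mxsimple rH M.
Proof.
move=> n_gt0; apply: NNPP => noM.
have nz1 : (1%:M : 'M[F]_n) != 0 by rewrite -mxrank_eq0 mxrank1 -lt0n.
suff: is_true false by [].
by apply: (mxsimple_exists (mxmodule1 rH) nz1) => -[M simM _]; case: noM; exists M.
Qed.

Lemma Clifford_constituent (R : idomainType) (F : fieldType)
    (rho : {rmorphism R -> F}) (ch2 : 2 \in [pchar F])
    (gT : finGroupType) (G N : {group gT}) (nsNG : (N <| G)%g)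
    n (rG : mx_representation F G n) (theta : {ffun gT -> R}) (M : 'M_n)
    (rN := subg_repr rG (normal_sub nsNG)) :
    mx_irreducible rG -> affords_brauer rho rG theta -> mxsimple rN M ->
  exists (X : {set gT}) (phi : gT -> {ffun gT -> R}),
    [/\ X \subset G, mxdirect (\sum_(x in X) M *m rG x),
        forall x (modMx : mxmodule rN (M *m rG x)), x \in X ->
             affords_brauer rho (submod_repr modMx) (phi x)
          /\ brauer_constituent rho N (phi x) (brauer_res N theta),
        brauer_res N theta = \sum_(x in X) phi x
      & exists x, x \in X].
Proof.
move=> irrG aff simM.
have [X [phi [sXG [sumX dxX] affX sum_phi]]] := Clifford_brauer ch2 irrG aff simM.
exists X, phi; split=> // [x modMx Xx|].
  split; first exact: affX.
  exists [seq phi z | z <- enum X]; split; last by rewrite map_f ?mem_enum.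
    move=> _ /mapP[z + ->]; rewrite mem_enum => Xz.
    have simMz := Clifford_simple simM (subsetP sXG z Xz).
    have [modMz _ _] := simMz; exists (\rank (M *m rG z)), (submod_repr modMz).
    by split; [apply/submod_mx_irr | apply: affX].
  by rewrite sum_phi big_map big_enum.
have [X0 | /set0Pn//] := eqVneq X set0; case/mx_irrP: irrG => n_gt0 _.
by move: n_gt0; rewrite -(mxrank1 F n) -sumX X0 big_set0 mxrank0.
Qed.

(** * Restricting [theta] to [N] *)

Theorem theorem3 (gT : finGroupType) (G N : {group gT})
    (K : fieldType) (R : idomainType) (F : fieldType)
    (iota : {rmorphism R -> K}) (rho : {rmorphism R -> F})
    (msKRF : modular_system 2 iota rho)
    (splitK : forall H : {group gT}, H \subset G -> group_splitting_field K H)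
    (splitF : forall H : {group gT}, H \subset G -> group_splitting_field F H)
    (nsNG : (N <| G)%g)
    (theta : {ffun gT -> R})
    (theta_nq : non_quadratic_type rho G theta)
    (not_over1 : ~ brauer_constituent rho N (brauer1 R N) (brauer_res N theta)) :
  exists s : seq {ffun gT -> R},
    [/\ uniq s,
        forall phi, phi \in s -> non_quadratic_type rho N phi
      & brauer_res N theta = \sum_(phi <- s) phi].
Proof.
have ch2 := ms_pchar_res msKRF; pose sNG := normal_sub nsNG.
have [[d [rG [irrG affG]]] theta_neq1 theta_dual theta_nquad] := theta_nq.
have absG : mx_absolutely_irreducible rG := splitF G (subxx _) _ _ irrG.
have [d_gt0 _] := (mx_irrP _).1 irrG.
have noQ : ~ has_invariant_quadratic_form rG.
  by move=> Q; apply: theta_nquad; split=> //; exists d, rG.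
pose rN := subg_repr rG sNG.
(* A nonzero [N]-fixed vector [u] spans a trivial simple submodule. Its translates [u *m rG x] are
   fixed too, as [N] is normal, so a Clifford constituent would be trivial. *)
have fixN : rfix_mx rG N = 0.
  apply/eqP/negPn/negP => /rowV0Pn[u fixu nzu]; apply: not_over1.
  have {}fixu := rfix_mxP _ fixu.
  have homu x : x \in N -> triv_repr F N x *m u = u *m rN x.
    by move=> Nx; rewrite mul1mx fixu.
  have irr1 : mx_irreducible (triv_repr F N) by apply/mx_abs_irrW/linear_mx_abs_irr.
  have simM := irr_hom_simple irr1 nzu homu.
  have [X [phi [sXG _ affX _ [x Xx]]]] := Clifford_constituent ch2 irrG affG simM.
  have Gx := subsetP sXG x Xx.
  have [modMx nzMx _] := Clifford_simple simM Gx.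
  have [affx] := affX x modMx Xx.
  suff aff1 : affords_brauer rho (submod_repr modMx) (brauer1 R N).
    by rewrite (affords_brauer_uniq ch2 affx aff1).
  have aff1 : affords_brauer rho (triv_repr F N) (brauer1 R N).
    exact: affords_brauer1.
  apply: affords_brauer_rsim aff1.
  have nzux : u *m rG x != 0.
    by apply: contraNneq nzu => ux0; rewrite -(repr_mxK rG Gx u) ux0 mul0mx.
  have homux y : y \in N -> triv_repr F N y *m (u *m rG x) = u *m rG x *m rN y.
    move=> Ny; rewrite mul1mx -mulmxA -repr_mxM // ?(subsetP sNG) //.
    have Nz : (y ^ x^-1)%g \in N.
      by rewrite memJ_norm // groupV (subsetP (normal_norm nsNG)).
    have -> : (x * y = y ^ x^-1 * x)%g by rewrite conjgE invgK !mulgA mulgKV.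
    by rewrite repr_mxM // ?(subsetP sNG) // mulmxA (fixu _ Nz).
  apply: (hom_rsim_submod _ _ _ homux); first exact: irr_hom_free irr1 nzux homux.
  exact/eqmxMr/eqmx_sym/genmxE.
(* [theta] is afforded by [rG] and by its dual; an isomorphism between them is a nondegenerate
   invariant form. *)
have [B invB uB] : exists2 B, inv_form rG B & B \in unitmx.
  have aff_dual : affords_brauer rho (dual_repr rG) theta.
    by rewrite -theta_dual; apply: affords_brauer_dual.
  have irr_dual := mx_abs_irrW (dual_mx_abs_irr absG).
  have [B _ freeB homB] :=
    affords_brauer_irr_rsim ch2 (splitF G (subxx _)) irrG irr_dual affG aff_dual.
  by exists B; [apply/inv_formP | rewrite -row_free_unit].
have [M simM] := mxsimple_inhabited rN d_gt0.
have [X [phi [sXG dxX affX sum_phi _]]] := Clifford_constituent ch2 irrG affG simM.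
have simX x : x \in X -> mxsimple rN (M *m rG x).
  by move/(subsetP sXG); apply: Clifford_simple.
have val_neq0 x : x \in X -> (val_submod 1%:M : 'M_(\rank (M *m rG x), d)) != 0.
  by move/simX=> [_ nzMx _]; rewrite (eqmx_eq0 (val_submod1 _)).
have valhom x (modMx : mxmodule rN (M *m rG x)) y : y \in N ->
    submod_repr modMx y *m val_submod 1%:M = val_submod 1%:M *m rG y.
  exact: (submod_homE modMx).
exists [seq phi x | x <- enum X]; split; last by rewrite sum_phi big_map big_enum.
  rewrite map_inj_in_uniq ?enum_uniq // => x y; rewrite !mem_enum => Xx Xy eq_phi.
  (* Equal characters make the summands at [x] and [y] isomorphic; [sub_mult_free] then puts the
     second inside the first, against directness. *)
  apply/eqP/negPn/negP=> neq_xy.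
  have [[modx nzx _] [mody nzy _]] := (simX x Xx, simX y Xy).
  have irrx : mx_irreducible (submod_repr modx) by apply/submod_mx_irr/simX.
  have irry : mx_irreducible (submod_repr mody) by apply/submod_mx_irr/simX.
  have [[affx _] [affy _]] := (affX x modx Xx, affX y mody Xy).
  rewrite -eq_phi in affy.
  have [C _ freeC homC] := affords_brauer_irr_rsim ch2 (splitF N sNG) irrx irry affx affy.
  pose w1 : 'M_(\rank (M *m rG x), d) := val_submod 1%:M.
  pose wy : 'M_(\rank (M *m rG y), d) := val_submod 1%:M.
  have hom2 z : z \in N -> submod_repr modx z *m (C *m wy) = C *m wy *m rG z.
    move=> Nz; rewrite mulmxA homC // -(mulmxA C (submod_repr mody z)).
    by rewrite (valhom y mody) // mulmxA.
  have le21 : (C *m wy <= w1)%MS.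
    apply: (sub_mult_free ch2 nsNG absG fixN uB invB noQ _ _ hom2 (val_neq0 x Xx)).
      exact: splitF irrx.
    exact: valhom.
  have dxx := mxdirect_sumsP dxX x Xx.
  have : (C *m wy <= M *m rG x :&: \sum_(z in X | z != x) M *m rG z)%MS.
    rewrite sub_capmx (submx_trans le21) ?val_submod1 //=.
    rewrite (submx_trans (submxMl _ _)) // val_submod1.
    by rewrite (sumsmx_sup y) // Xy eq_sym.
  have freey : row_free wy by rewrite /row_free /wy val_submod1.
  by rewrite dxx submx0 -mxrank_eq0 mxrankMfree // (eqP freeC) mxrank_eq0 (negPf nzx).
move=> _ /mapP[x + ->]; rewrite mem_enum => Xx.
have [modx nzx _] := simX x Xx; have [affx over_x] := affX x modx Xx.
have irrx : mx_irreducible (submod_repr modx) by apply/submod_mx_irr/simX.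
have absx := splitF N sNG _ _ irrx.
have homx := valhom x modx.
have uC := sub_form_unit ch2 nsNG absG fixN uB invB noQ absx homx (val_neq0 x Xx).
have invC := sub_inv_form nsNG invB homx.
split.
- by exists (\rank (M *m rG x)), (submod_repr modx).
- by move=> phi1; apply: not_over1; rewrite -phi1.
(* The restriction of [B] to the summand is nondegenerate, so it is an isomorphism onto the dual. *)
- apply/esym; apply: (affords_brauer_uniq ch2 affx).
  apply: affords_brauer_rsim (affords_brauer_dual affx); apply: mx_rsim_sym.
  by exists (val_submod 1%:M *m B *m (val_submod 1%:M)^T);
    rewrite ?row_free_unit //; apply/inv_formP.
case=> _ [m [rH [irrH affH QH]]].
apply: (sub_nonquadratic ch2 nsNG absG fixN uB invB noQ absx homx (val_neq0 x Xx)).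
apply: has_invariant_quadratic_form_rsim QH.
exact: (affords_brauer_irr_rsim ch2 (splitF N sNG) irrH irrx affH affx).
Qed.
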